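(* Let $\mathcal{M}=(\pi,x)$ be an incentive compatible and individually rational auction mechanism whose payments satisfy, for all $i$, $\mathbf{p}$, $\mathbf{c}_{-i}$ and $c_i$, $$x_i(c_i,\mathbf{c}_{-i},\mathbf{p})=v_i(c_i,p_i)\pi_i(c_i,\mathbf{c}_{-i},\mathbf{p})-\lambda_i(p_i)\int_{c_i}^{\overline{c}_i}\pi_i(z,\mathbf{c}_{-i},\mathbf{p})\,dz.$$ Fix a display price profile $\mathbf{p}$ (not depending on the costs). Then the platform's expected revenue equals the expected virtual social welfare: $$\mathrm{E}_{\mathbf{c}\sim\mathcal{C}}\Big[\sum_{i=1}^{n}x_i(\mathbf{c},\mathbf{p})\Big]=\mathrm{E}_{\mathbf{c}\sim\mathcal{C}}\Big[\sum_{i=1}^{n}\pi_i(\mathbf{c},\mathbf{p})\phi_i(c_i,p_i)\Big],\qquad \phi_i(c_i,p_i)=v_i(c_i,p_i)-\lambda_i(p_i)\frac{\mathcal{C}_i(c_i)}{\mathcal{C}_i'(c_i)}.$$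
   Context: There are advertisers $N=\{1,\dots,n\}$ competing for a single ad slot. Advertiser $i$ has a private product cost $c_i\in[\underline{c}_i,\overline{c}_i]$; costs are drawn independently, $c_i$ from a distribution with cumulative distribution function $\mathcal{C}_i$ and density $\mathcal{C}_i'$, and $\mathcal{C}$ denotes the joint (product) distribution. Advertiser $i$ sets a display price $p_i$, has conversion-rate function $\lambda_i:\mathbb{R}\to(0,1]$ and value $v_i(c_i,p_i)=(p_i-c_i)\lambda_i(p_i)$. An auction mechanism maps cost reports and display prices $(\mathbf{c}',\mathbf{p})$ to allocations $\pi_i(\mathbf{c}',\mathbf{p})\in\{0,1\}$ (at most one winner) and payments $x_i(\mathbf{c}',\mathbf{p})$; utility is $u_i=v_i(c_i,p_i)\pi_i-x_i$. IC: truthful cost reporting maximizes $u_i$ for all $i$, true costs, prices and others' reports. IR: truthful cost reporting yields $u_i\ge0$ always. $\mathbf{c}$ denotes truthful cost reports.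
   Formalization: Each density is assumed strictly positive on the open cost interval (otherwise the virtual value is undefined and the identity can fail when the density vanishes on a gap), and allocations are assumed measurable in the costs; the expectation is written as an iterated integral. *)

(* Defs.v *)
From HB Require Import structures.
From mathcomp Require Import all_boot all_order all_algebra.
From mathcomp Require Import all_classical all_reals all_analysis.
Set Implicit Arguments. Unset Strict Implicit. Unset Printing Implicit Defensive.
Import Order.TTheory GRing.Theory Num.Theory.
Import numFieldNormedType.Exports.
Local Open Scope classical_set_scope.
Local Open Scope ring_scope.

Section Auction.
Variable R : realType.

Definition int_ab (a b : R) (f : R -> R) : R :=
  (\int[@lebesgue_measure R]_(z in `[a, b]) f z)%R.

Definition upd (n : nat) (c : n.-tuple R) (i : 'I_n) (z : R) : n.-tuple R :=
  [tuple (if j == i then z else tnth c j) | j < n].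

Definition in_supp (n : nat) (lo hi : nat -> R) (c : n.-tuple R) : Prop :=
  forall i : 'I_n, lo i <= tnth c i <= hi i.

(* Expectation w.r.t. independent costs, coordinate k having density
   dens k on [lo k, hi k], written as the iterated integral
   E[F] = int_{lo_0}^{hi_0} dens_0(c_0) ... int_{lo_{n-1}}^{hi_{n-1}}
          dens_{n-1}(c_{n-1}) F(c_0,...,c_{n-1}) dc_{n-1} ... dc_0. *)
Fixpoint iterE (n : nat) (lo hi : nat -> R) (dens : nat -> R -> R)
  : (n.-tuple R -> R) -> R :=
  match n with
  | 0 => fun F => F [tuple]
  | m.+1 => fun F =>
      int_ab (lo 0) (hi 0) (fun z => dens 0 z *
        iterE (fun k => lo k.+1) (fun k => hi k.+1) (fun k => dens k.+1)
          (fun t : m.-tuple R => F (cons_tuple z t)))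
  end.

Definition value (lam : nat -> R -> R) (i : nat) (ci pi : R) : R :=
  (pi - ci) * lam i pi.

(* utility of advertiser i with true cost ci under reports c and prices p *)
Definition utility (n : nat) (lam : nat -> R -> R)
  (alloc pay : n.-tuple R -> n.-tuple R -> 'I_n -> R)
  (i : 'I_n) (ci : R) (c p : n.-tuple R) : R :=
  value lam i ci (tnth p i) * alloc c p i - pay c p i.

Definition virtual_value (lam : nat -> R -> R) (C dens : nat -> R -> R)
  (i : nat) (ci pi : R) : R :=
  value lam i ci pi - lam i pi * (C i ci / dens i ci).

End Auction.

(* Main.v *)
(** The payment rule makes the revenue from advertiser [i] equal to the value
    term minus [lam_i] times the information rent, the integral of the
    allocation over costs above [c_i].  Integrating the rent against the density
    [dens_i] and exchanging the two integrals over the triangle [c_i <= z]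
    replaces the density by its primitive [C_i]; writing
    [C_i = dens_i * (C_i / dens_i)] turns this back into an expectation, that of
    the allocation times [C_i / dens_i].  The expectation being an iterated
    integral, the exchange is proved by induction on the number of coordinates,
    moving the inner coordinates past the [z]-integral with Fubini. *)

Require Import Defs.
From HB Require Import structures.
From mathcomp Require Import all_boot all_order all_algebra.
From mathcomp Require Import all_classical all_reals all_analysis.
From mathcomp Require Import measurable_realfun.
Import Order.TTheory GRing.Theory Num.Theory.
Import numFieldNormedType.Exports.
Local Open Scope classical_set_scope.
Local Open Scope ring_scope.

(** * Measurability in a parameter, bounds, and Fubini for real-valued integrals *)

Section RealIntegrals.
Context {R : realType}.
Notation mu := (@lebesgue_measure R).

(** Inversion is continuous only off 0, an open set; at 0 its value is 0 by convention, so the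
    domain is split there. *)
Lemma measurable_invr : measurable_fun [set: R] (@GRing.inv R).
Proof.
rewrite (_ : @GRing.inv R = fun x => if x == 0 then 0 else x^-1); last first.
  by apply/funext => x; case: eqP => // ->; rewrite invr0.
apply: measurable_fun_if => //; first exact: measurable_fun_eqr.
rewrite setTI; apply: open_continuous_measurable_fun.
  rewrite (_ : _ @^-1` _ = ~` [set 0]); last first.
    apply/seteqP; split => x /=; first by move=> /eqP.
    by move=> /eqP/negbTE.
  by rewrite openC; exact: closed_eq.
by move=> x; rewrite inE /= => /negbT x0; exact: inv_continuous.
Qed.

Lemma integrable_cst_itv (a b k : R) : mu.-integrable `[a, b] (EFin \o cst k).
Proof.
apply: measurable_bounded_integrable => //.
  by rewrite /= lebesgue_measure_itv /=; case: ifP => _; rewrite ?ltry// -EFinD ltry.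
by exists `|k|; split => // M kM x _ /=; exact: ltW.
Qed.

(** Tonelli makes the integrals of the positive and negative parts measurable in the parameter as
    extended reals; [fine] of their difference is then measurable, whatever values are infinite. *)
Lemma measurable_Rintegral_param {d} {T : measurableType d} (f : T * R -> R) :
  measurable_fun setT f ->
  measurable_fun setT (fun t => \int[mu]_y f (t, y)).
Proof.
move=> mf; apply: (measurableT_comp (f := fine)); first exact: fine_measurable.
under eq_fun do rewrite integralE.
have mfE : measurable_fun setT (EFin \o f) by exact/measurable_EFinP.
apply: emeasurable_funB.
- rewrite (_ : (fun _ => _) = fubini_F mu (EFin \o f)^\+%E).
    by apply: measurable_fun_fubini_tonelli_F => //; exact: measurable_funepos.
  by apply/funext => t; apply: eq_integral => y _; rewrite !funeposE.
- rewrite (_ : (fun _ => _) = fubini_F mu (EFin \o f)^\-%E).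
    by apply: measurable_fun_fubini_tonelli_F => //; exact: measurable_funeneg.
  by apply/funext => t; apply: eq_integral => y _; rewrite !funenegE.
Qed.

(** The moving endpoints are absorbed into an indicator, measurable jointly in the parameter and the
    variable, so that the domain of integration becomes fixed. *)
Lemma measurable_int_ab_param {d} {T : measurableType d} (a b : T -> R)
    (f : T * R -> R) :
  measurable_fun setT a -> measurable_fun setT b -> measurable_fun setT f ->
  measurable_fun setT (fun t => int_ab (a t) (b t) (fun y => f (t, y))).
Proof.
move=> ma mb mf.
pose g (z : T * R) := if (a z.1 <= z.2) && (z.2 <= b z.1) then f z else 0.
rewrite (_ : (fun _ => _) = fun t => \int[mu]_y g (t, y)); last first.
  apply/funext => t; rewrite /int_ab Rintegral_mkcond; apply: eq_Rintegral => y _.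
  by rewrite patchE mem_setE in_itv.
apply: measurable_Rintegral_param; apply: measurable_fun_ifT => //.
by apply: measurable_and; apply: measurable_fun_ler => //; exact: measurableT_comp.
Qed.

Lemma eq_int_ab (a b : R) (f g : R -> R) :
  (forall x, a <= x <= b -> f x = g x) -> int_ab a b f = int_ab a b g.
Proof.
by move=> fg; apply: eq_Rintegral => x; rewrite inE /= in_itv /=; exact: fg.
Qed.

Lemma norm_int_ab_le (a b M : R) (f : R -> R) :
  measurable_fun setT f -> 0 <= M -> (forall x, a <= x <= b -> `|f x| <= M) ->
  `|int_ab a b f| <= M * `|b - a|.
Proof.
move=> mf M0 fM; have iM := integrable_cst_itv a b M.
have if_ : mu.-integrable `[a, b] (EFin \o f).
  apply: le_integrable iM => //; first exact/measurable_EFinP/measurable_funTS.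
  by move=> x /=; rewrite in_itv/= => /fM; rewrite lee_fin (ger0_norm M0).
apply: le_trans (le_normr_Rintegral _ if_) _ => //.
apply: (@le_trans _ _ (\int[mu]_(x in `[a, b]) cst M x)).
  by apply: le_Rintegral => //; exact: integrable_norm.
rewrite Rintegral_cst// ler_wpM2l//= lebesgue_measure_itv/=.
by case: ifP => _ //=; rewrite ler_norm.
Qed.

(** The product bound makes [f] integrable on the plane, its absolute integral being at most that of
    [|g|] times that of [|k|]. It also makes every section integrable, not just almost every one, so
    that [fine] can be cancelled inside both iterated integrals. *)
Lemma Rintegral_Fubini_dominated (f : R * R -> R) (g k : R -> R) :
  measurable_fun setT f ->
  mu.-integrable setT (EFin \o g) -> mu.-integrable setT (EFin \o k) ->
  (forall x y, `|f (x, y)| <= `|g x| * `|k y|) ->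
  \int[mu]_x (\int[mu]_y f (x, y)) = \int[mu]_y (\int[mu]_x f (x, y)).
Proof.
move=> mf ig ik fgk.
have mfE : measurable_fun setT (EFin \o f) by exact/measurable_EFinP.
have i1 x : mu.-integrable setT (fun y => (f (x, y))%:E).
  apply: (le_integrable _ _ _ (integrableZl _ (g x) ik)) => //.
    by apply/measurable_EFinP/measurableT_comp => //; exact: measurable_pair1.
  by move=> y _ /=; rewrite lee_fin normrM.
have i2 y : mu.-integrable setT (fun x => (f (x, y))%:E).
  apply: (le_integrable _ _ _ (integrableZl _ (k y) ig)) => //.
    by apply/measurable_EFinP/measurableT_comp => //; exact: measurable_pair2.
  by move=> x _ /=; rewrite lee_fin normrM mulrC.
have Ef : (mu \x mu)%E.-integrable setT (EFin \o f).
  apply/integrable12ltyP => //=.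
  have /integrableP[mg goo] := integrable_abse ig.
  have /integrableP[mk koo] := integrable_abse ik.
  apply: (@le_lt_trans _ _ (\int[mu]_x (`|(g x)%:E| * \int[mu]_y `|(k y)%:E|))%E).
    apply: ge0_le_integral => //.
    - by move=> x _; exact: integral_ge0.
    - apply: (@measurable_fun_fubini_tonelli_F _ _ _ _ R mu
               (fun z => `|(EFin \o f) z|%E)) => //.
      exact: measurableT_comp.
    - by apply: emeasurable_funM => //; exact: measurable_int ig.
    move=> x _; rewrite -ge0_integralZl//.
    apply: ge0_le_integral => //.
    - exact: (measurable_int mu (integrable_abse (i1 x))).
    - exact: (measurable_int mu (integrableZl measurableT `|g x| (integrable_abse ik))).
    - by move=> y _ /=; rewrite lee_fin.
  rewrite ge0_integralZr//; last exact: integral_ge0.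
  apply: lte_mul_pinfty.
  - exact: integral_ge0.
  - by rewrite ge0_fin_numE ?integral_ge0//; under eq_integral do rewrite -abse_id.
  - by under eq_integral do rewrite -abse_id.
rewrite /Rintegral.
under eq_integral do rewrite fineK ?integrable_fin_num//.
under [in RHS]eq_integral do rewrite fineK ?integrable_fin_num//.
by rewrite (Fubini Ef).
Qed.

End RealIntegrals.

(** * Iterated expectations: linearity, measurability, integrability *)

Section IteratedExpectation.
Set Implicit Arguments.
Unset Strict Implicit.
Context {R : realType}.
Notation mu := (@lebesgue_measure R).

(** Integrability is demanded at each level and for every value of the outer coordinates in range:
    linearity of [iterE] is proved level by level, using linearity of the inner expectation at each
    point. *)
Fixpoint iter_integrable (n : nat) (lo hi : nat -> R) (dens : nat -> R -> R)
  : (n.-tuple R -> R) -> Prop :=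
  match n with
  | 0 => fun _ => True
  | m.+1 => fun F =>
      (forall z, lo 0 <= z <= hi 0 ->
        iter_integrable (fun k => lo k.+1) (fun k => hi k.+1)
          (fun k => dens k.+1) (fun t : m.-tuple R => F (cons_tuple z t))) /\
      mu.-integrable `[lo 0, hi 0] (EFin \o (fun z => dens 0 z *
        iterE (fun k => lo k.+1) (fun k => hi k.+1) (fun k => dens k.+1)
          (fun t : m.-tuple R => F (cons_tuple z t))))
  end.

Lemma in_supp_cons (n : nat) (lo hi : nat -> R) (z : R) (t : n.-tuple R) :
  lo 0 <= z <= hi 0 -> in_supp (fun k => lo k.+1) (fun k => hi k.+1) t ->
  in_supp lo hi (cons_tuple z t).
Proof.
move=> zb tb i; case: (unliftP ord0 i) => [j|] ->; last by rewrite tnth0.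
by rewrite tnthS lift0; exact: tb.
Qed.

Lemma upd_cons0 (n : nat) (z y : R) (t : n.-tuple R) :
  upd (cons_tuple z t) ord0 y = cons_tuple y t.
Proof.
apply: eq_from_tnth => i; rewrite tnth_mktuple.
by case: (unliftP ord0 i) => [j|] ->; rewrite ?eqxx ?tnth0// !tnthS.
Qed.

Lemma upd_consS (n : nat) (z y : R) (t : n.-tuple R) (j : 'I_n) :
  upd (cons_tuple z t) (lift ord0 j) y = cons_tuple z (upd t j y).
Proof.
apply: eq_from_tnth => i; rewrite tnth_mktuple.
case: (unliftP ord0 i) => [k|] ->; last by rewrite !tnth0.
by rewrite !tnthS tnth_mktuple (inj_eq lift_inj).
Qed.

(** Only values on the support enter the integrals, so a density may be altered elsewhere, for
    instance to make it globally integrable. *)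
Lemma eq_iterE (n : nat) (lo hi : nat -> R) (d e : nat -> R -> R)
    (F G : n.-tuple R -> R) :
  (forall (i : 'I_n) z, lo i <= z <= hi i -> d i z = e i z) ->
  (forall c, in_supp lo hi c -> F c = G c) ->
  iterE lo hi d F = iterE lo hi e G.
Proof.
elim: n lo hi d e F G => [|n IH] lo hi d e F G de FG /=.
  by apply: FG => -[].
apply: eq_int_ab => z zb; rewrite (de ord0)//; congr (_ * _).
apply: IH => [i x xb|c cb]; first by apply: (de (lift ord0 i)); rewrite lift0.
by apply: FG; exact: in_supp_cons.
Qed.

Lemma iterED (n : nat) (lo hi : nat -> R) (d : nat -> R -> R)
    (F G : n.-tuple R -> R) :
  iter_integrable lo hi d F -> iter_integrable lo hi d G ->
  iter_integrable lo hi d (fun c => F c + G c) /\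
  iterE lo hi d (fun c => F c + G c) = iterE lo hi d F + iterE lo hi d G.
Proof.
elim: n lo hi d F G => [|n IH] lo hi d F G //= [F1 iF] [G1 iG].
have E z : lo 0%N <= z <= hi 0%N -> _ := fun zb => (IH _ _ _ _ _ (F1 z zb) (G1 z zb)).2.
split; first split.
- by move=> z zb; apply: (IH _ _ _ _ _ _ _).1; [exact: F1|exact: G1].
- apply: eq_integrable (integrableD _ iF iG) => // z; rewrite inE/= in_itv/= => zb.
  by rewrite E// mulrDr.
- rewrite /int_ab -RintegralD//; apply: (@eq_int_ab R (lo 0%N) (hi 0%N)) => z zb.
  by rewrite E// mulrDr.
Qed.

Lemma iterEZ (n : nat) (lo hi : nat -> R) (d : nat -> R -> R) (k : R)
    (F : n.-tuple R -> R) :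
  iter_integrable lo hi d F ->
  iter_integrable lo hi d (fun c => k * F c) /\
  iterE lo hi d (fun c => k * F c) = k * iterE lo hi d F.
Proof.
elim: n lo hi d F => [|n IH] lo hi d F //= [F1 iF].
have E z : lo 0%N <= z <= hi 0%N -> _ := fun zb => (IH _ _ _ _ (F1 z zb)).2.
split; first split.
- by move=> z zb; apply: (IH _ _ _ _ _).1; exact: F1.
- apply: eq_integrable (integrableZl _ k iF) => // z; rewrite inE/= in_itv/= => zb.
  by rewrite E// mulrCA.
- rewrite /int_ab -RintegralZl//; apply: (@eq_int_ab R (lo 0%N) (hi 0%N)) => z zb.
  by rewrite E// mulrCA.
Qed.

Lemma iterE_cst0 (n : nat) (lo hi : nat -> R) (d : nat -> R -> R) :
  iter_integrable lo hi d (fun _ : n.-tuple R => 0) /\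
  iterE lo hi d (fun _ : n.-tuple R => 0) = 0.
Proof.
elim: n lo hi d => [|n IH] lo hi d //=.
have E := (IH (fun k => lo k.+1) (fun k => hi k.+1) (fun k => d k.+1)).2.
split; first split.
- by move=> z _; exact: (IH _ _ _).1.
- by apply: eq_integrable (integrable_cst_itv _ _ 0) => // z _ /=; rewrite E mulr0.
- rewrite -[RHS](mul0r (fine (mu `[lo 0%N, hi 0%N]))) -Rintegral_cst//.
  by apply: eq_int_ab => z _; rewrite E mulr0.
Qed.

Lemma iterE_sum (n : nat) (lo hi : nat -> R) (d : nat -> R -> R)
    (I : Type) (s : seq I) (F : I -> n.-tuple R -> R) :
  (forall i, iter_integrable lo hi d (F i)) ->
  iter_integrable lo hi d (fun c => \sum_(i <- s) F i c) /\
  iterE lo hi d (fun c => \sum_(i <- s) F i c) = \sum_(i <- s) iterE lo hi d (F i).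
Proof.
move=> iF; elim: s => [|i s [IH1 IH2]].
  rewrite big_nil; under [X in iter_integrable _ _ _ X]eq_fun do rewrite big_nil.
  by under [X in iterE _ _ _ X]eq_fun do rewrite big_nil; exact: iterE_cst0.
rewrite big_cons; under [X in iter_integrable _ _ _ X]eq_fun do rewrite big_cons.
by under [X in iterE _ _ _ X]eq_fun do rewrite big_cons; rewrite -IH2; exact: iterED.
Qed.

(** The parameter space is arbitrary because the induction moves the first coordinate into it: [T]
    becomes [T * R] for the remaining ones. *)
Lemma measurable_iterE_param {d} {T : measurableType d} (n : nat)
    (lo hi : nat -> R) (dens : nat -> R -> R) (F : T * n.-tuple R -> R) :
  (forall k, measurable_fun setT (dens k)) -> measurable_fun setT F ->
  measurable_fun setT (fun t => iterE lo hi dens (fun c => F (t, c))).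
Proof.
elim: n d T lo hi dens F => [|n IH] d T lo hi dens F mdens mF /=.
  by apply: measurableT_comp => //; exact: measurable_pair2.
pose G (z : (T * R) * n.-tuple R) := F (z.1.1, cons_tuple z.1.2 z.2).
apply: (measurable_int_ab_param (fun=> lo 0%N) (fun=> hi 0%N)
  (fun z => dens 0%N z.2 * iterE (fun k => lo k.+1) (fun k => hi k.+1)
     (fun k => dens k.+1) (fun c => G (z, c)))) => //.
apply: measurable_funM; first exact: measurableT_comp.
apply: (IH _ _ _ _ _ G) => //.
apply: measurableT_comp => //; apply: measurable_fun_pair.
  by apply: measurableT_comp.
by apply: measurable_cons => //; exact: measurableT_comp.
Qed.

(* [B] is chosen before [F] so that it bounds all sections [F (z :: _)] at once
   in the induction. *)
Lemma iter_integrable_dominated (n : nat) (lo hi : nat -> R)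
    (dens h : nat -> R -> R) :
  (forall k, measurable_fun setT (dens k)) ->
  (forall k z, 0 <= h k z) ->
  (forall k, mu.-integrable `[lo k, hi k] (EFin \o (fun z => dens k z * h k z))) ->
  exists2 B, 0 <= B & forall (F : n.-tuple R -> R) (K : R),
    0 <= K -> measurable_fun setT F ->
    (forall c, in_supp lo hi c -> `|F c| <= K * \prod_(j < n) h j (tnth c j)) ->
    iter_integrable lo hi dens F /\ `|iterE lo hi dens F| <= K * B.
Proof.
elim: n lo hi dens h => [|n IH] lo hi dens h mdens h0 ih.
  exists 1 => // F K K0 mF FK; split => //=.
  by have := FK [tuple]; rewrite big_ord0; apply => -[].
have [B B0 HB] := IH (fun k => lo k.+1) (fun k => hi k.+1) (fun k => dens k.+1)
  (fun k => h k.+1) (fun k => mdens k.+1) (fun k => h0 k.+1) (fun k => ih k.+1).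
have J0 : 0 <= \int[mu]_(z in `[lo 0%N, hi 0%N]) `|dens 0%N z * h 0%N z|.
  by apply: Rintegral_ge0.
(* The section at [z] is dominated with constant [K * h 0 z]; integrating this against [dens 0]
   contributes the second factor. *)
exists (B * \int[mu]_(z in `[lo 0%N, hi 0%N]) `|dens 0%N z * h 0%N z|).
  exact: mulr_ge0.
move=> F K K0 mF FK.
have mFz z : measurable_fun setT (fun t : n.-tuple R => F (cons_tuple z t)).
  by apply: measurableT_comp => //; exact: measurable_cons.
pose A z := iterE (fun k => lo k.+1) (fun k => hi k.+1) (fun k => dens k.+1)
  (fun t : n.-tuple R => F (cons_tuple z t)).
have Fz z : lo 0%N <= z <= hi 0%N ->
    iter_integrable (fun k => lo k.+1) (fun k => hi k.+1) (fun k => dens k.+1)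
      (fun t : n.-tuple R => F (cons_tuple z t)) /\
    `|A z| <= K * h 0%N z * B.
  move=> zb; apply: HB => //; first exact: mulr_ge0.
  move=> c cb; apply: le_trans (FK _ (in_supp_cons zb cb)) _.
  rewrite big_ord_recl tnth0 mulrA.
  by under eq_bigr do rewrite tnthS lift0.
have mA : measurable_fun setT A.
  apply: (@measurable_iterE_param _ _ n _ _ _
    (fun zt : R * n.-tuple R => F (cons_tuple zt.1 zt.2))) => //.
  by apply: measurableT_comp => //; exact: measurable_cons.
have Ab z : lo 0%N <= z <= hi 0%N ->
    `|dens 0%N z * A z| <= K * B * `|dens 0%N z * h 0%N z|.
  move=> /Fz[_ Az]; rewrite !normrM (ger0_norm (h0 0%N z)) mulrCA.
  by rewrite ler_wpM2l// (le_trans Az)// mulrAC.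
have iKB : mu.-integrable `[lo 0%N, hi 0%N]
    (EFin \o (fun z => K * B * `|dens 0%N z * h 0%N z|)).
  apply: eq_integrable (integrableZl _ (K * B) (integrable_norm (ih 0%N))) => //.
have iA : mu.-integrable `[lo 0%N, hi 0%N] (EFin \o (fun z => dens 0%N z * A z)).
  apply: le_integrable iKB => //.
    apply/measurable_EFinP/measurable_funTS.
    by apply: measurable_funM; [exact: mdens|exact: mA].
  move=> z /=; rewrite in_itv/= => /Ab Az; rewrite lee_fin (le_trans Az)//.
  by rewrite ler_norm.
split; first by split => // z /Fz[].
apply: le_trans (le_normr_Rintegral _ iA) _ => //.
rewrite mulrA -RintegralZl//; last exact: (integrable_norm (ih 0%N)).
by apply: le_Rintegral => //; exact: (integrable_norm iA).
Qed.

End IteratedExpectation.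

(** * Exchange of integrals over rectangles and triangles *)

Section RealExchange.
Set Implicit Arguments.
Unset Strict Implicit.
Context {R : realType}.
Notation mu := (@lebesgue_measure R).

Lemma measurable_integrableT (f : R -> R) :
  mu.-integrable setT (EFin \o f) -> measurable_fun setT f.
Proof. by move=> /integrableP[mf _]; exact/measurable_EFinP. Qed.

(** Endpoints are null. This matters for division by a density, which is known to be nonzero only in
    the open interval. *)
Lemma eq_int_ab_oo (a b : R) (f g : R -> R) :
  measurable_fun setT f -> measurable_fun setT g ->
  (forall x, a < x < b -> f x = g x) -> int_ab a b f = int_ab a b g.
Proof.
move=> mf mg fg; rewrite /int_ab /Rintegral; congr fine.
rewrite [LHS]integral_itv_bndoo; last exact/measurable_EFinP/measurable_funTS.
rewrite [RHS]integral_itv_bndoo; last exact/measurable_EFinP/measurable_funTS.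
by apply: eq_integral => x; rewrite inE/= in_itv/= => /fg ->.
Qed.

Lemma int_ab_lower_if (a b c : R) (f : R -> R) : a <= c ->
  int_ab c b f = int_ab a b (fun y => if c <= y then f y else 0).
Proof.
move=> ac; rewrite /int_ab [LHS]Rintegral_mkcond [RHS]Rintegral_mkcond.
apply: eq_Rintegral => y _; rewrite !patchE !mem_setE !in_itv/=.
by case: (leP c y) => cy; [rewrite (le_trans ac cy)|case: ifP].
Qed.

Lemma int_ab_upper_if (a b c : R) (f : R -> R) : c <= b ->
  int_ab a c f = int_ab a b (fun y => if y <= c then f y else 0).
Proof.
move=> cb; rewrite /int_ab [LHS]Rintegral_mkcond [RHS]Rintegral_mkcond.
apply: eq_Rintegral => y _; rewrite !patchE !mem_setE !in_itv/=.
case: (leP y c) => yc; first by rewrite (le_trans yc cb).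
by rewrite andbF; case: ifP.
Qed.

(** Extension by zero off the rectangle reduces this to Fubini on the plane, the dominating product
    being [g] times the constant [B] cut off to [[l, h]]. The factor [g] may be unbounded, as a
    density can be. *)
Lemma int_abC (a b l h B : R) (G : R * R -> R) (g : R -> R) :
  measurable_fun setT G -> mu.-integrable setT (EFin \o g) ->
  (forall x y, `|G (x, y)| <= `|g x| * B) ->
  int_ab a b (fun x => int_ab l h (fun y => G (x, y))) =
  int_ab l h (fun y => int_ab a b (fun x => G (x, y))).
Proof.
move=> mG ig GB.
pose f (z : R * R) := if ((a <= z.1) && (z.1 <= b)) && ((l <= z.2) && (z.2 <= h))
  then G z else 0.
have mf : measurable_fun setT f.
  apply: measurable_fun_ifT => //.
  by repeat apply: measurable_and; apply: measurable_fun_ler.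
have ik : mu.-integrable setT (EFin \o ((cst B) \_ `[l, h])).
  rewrite -restrict_EFin; apply: (integrable_mkcond _ _).1 => //.
  exact: integrable_cst_itv.
have fB x y : `|f (x, y)| <= `|g x| * `|((cst B) \_ `[l, h]) y|.
  rewrite /f patchE mem_setE in_itv/=.
  case: (a <= x <= b); case: (l <= y <= h); rewrite /= ?normr0 ?mulr0//.
  by rewrite (le_trans (GB x y))// ler_wpM2l// ler_norm.
have := Rintegral_Fubini_dominated f g _ mf ig ik fB.
congr (_ = _); rewrite /int_ab [RHS]Rintegral_mkcond; apply: eq_Rintegral => x _;
    rewrite patchE mem_setE in_itv/= /f/=.
- case: (a <= x <= b) => /=; last by rewrite Rintegral_cst// mul0r.
  rewrite [RHS]Rintegral_mkcond; apply: eq_Rintegral => y _.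
  by rewrite patchE mem_setE in_itv.
- case: (l <= x <= h) => /=.
    rewrite [RHS]Rintegral_mkcond; apply: eq_Rintegral => y _.
    by rewrite patchE mem_setE in_itv andbT.
  under eq_Rintegral do rewrite andbF.
  by rewrite Rintegral_cst// mul0r.
Qed.

Lemma integrable_bounded_itv (a b B : R) (f : R -> R) :
  measurable_fun setT f -> (forall x, `|f x| <= B) ->
  mu.-integrable `[a, b] (EFin \o f).
Proof.
move=> mf fB; apply: le_integrable (integrable_cst_itv a b B) => //.
  exact/measurable_EFinP/measurable_funTS.
by move=> x _ /=; rewrite lee_fin (le_trans (fB x))// ler_norm.
Qed.

(** Cutting [d x * A y] off to [x <= y] turns both sides into iterated integrals over the same
    square, taken in opposite orders. *)
Lemma int_ab_triangle (a b B : R) (d A : R -> R) :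
  mu.-integrable setT (EFin \o d) -> measurable_fun setT A ->
  (forall y, `|A y| <= B) ->
  int_ab a b (fun x => d x * int_ab x b A) =
  int_ab a b (fun y => int_ab a y d * A y).
Proof.
move=> id mA AB; have B0 : 0 <= B := le_trans (normr_ge0 _) (AB 0).
have md := measurable_integrableT id.
pose G (z : R * R) := if z.1 <= z.2 then d z.1 * A z.2 else 0.
have := @int_abC a b a b B G d _ id _.
have mG : measurable_fun setT G.
  apply: measurable_fun_ifT => //; first exact: measurable_fun_ler.
  by apply: measurable_funM; exact: measurableT_comp.
have GB x y : `|G (x, y)| <= `|d x| * B.
  rewrite /G/=; case: ifP => _; last by rewrite normr0 mulr_ge0.
  by rewrite normrM ler_wpM2l.
move=> /(_ mG GB) E.
transitivity (int_ab a b (fun x => int_ab a b (fun y => G (x, y)))).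
  apply: eq_int_ab => x /andP[ax xb].
  rewrite /G/= -(@int_ab_lower_if _ _ _ (fun y => d x * A y))//.
  by rewrite /int_ab RintegralZl//; exact: integrable_bounded_itv AB.
rewrite E; apply: eq_int_ab => y /andP[ay yb].
rewrite /G/= -(@int_ab_upper_if _ _ _ (fun x => d x * A y))//.
by rewrite /int_ab RintegralZr//; exact: integrableS id.
Qed.

Lemma iter_integrable_bounded (n : nat) (lo hi : nat -> R) (d : nat -> R -> R) :
  (forall k, mu.-integrable setT (EFin \o d k)) ->
  exists2 B, 0 <= B & forall (F : n.-tuple R -> R) (K : R),
    0 <= K -> measurable_fun setT F -> (forall c, `|F c| <= K) ->
    iter_integrable lo hi d F /\ `|iterE lo hi d F| <= K * B.
Proof.
move=> id.
have [|//||B B0 HB] := @iter_integrable_dominated R n lo hi d (fun _ _ => 1).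
- by move=> k; exact: measurable_integrableT (id k).
- move=> k; have ik : mu.-integrable `[lo k, hi k] (EFin \o d k).
    exact: integrableS (id k).
  by apply: eq_integrable ik => // x _ /=; rewrite mulr1.
exists B => // F K K0 mF FK; apply: HB => // c _.
by rewrite big1// mulr1.
Qed.

End RealExchange.

(** * Exchange of an iterated expectation with one integral *)

Section IteratedExchange.
Set Implicit Arguments.
Unset Strict Implicit.
Context {R : realType}.
Notation mu := (@lebesgue_measure R).

(** The induction hypothesis moves the inner coordinates past the integral. What remains is [d 0]
    times an inner expectation bounded by [M * B] uniformly in both variables, so [int_abC] applies
    with [d 0] as dominating function. *)
Lemma iterE_int_ab (n : nat) (lo hi : nat -> R) (d : nat -> R -> R) (l h M : R)
    (H : n.-tuple R * R -> R) :
  (forall k, mu.-integrable setT (EFin \o d k)) ->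
  measurable_fun setT H -> (forall z, `|H z| <= M) ->
  iterE lo hi d (fun c => int_ab l h (fun y => H (c, y))) =
  int_ab l h (fun y => iterE lo hi d (fun c => H (c, y))).
Proof.
elim: n lo hi d H => [|n IH] lo hi d H id mH HM //=.
have M0 : 0 <= M := le_trans (normr_ge0 _) (HM ([tuple 0 | _ < n.+1], 0)).
have md k := measurable_integrableT (id k).
have [B B0 HB] := @iter_integrable_bounded R n (fun k => lo k.+1)
  (fun k => hi k.+1) (fun k => d k.+1) (fun k => id k.+1).
pose G (z : (R * R) * n.-tuple R) := H (cons_tuple z.1.1 z.2, z.1.2).
pose A (z : R * R) := iterE (fun k => lo k.+1) (fun k => hi k.+1) (fun k => d k.+1)
  (fun t => G (z, t)).
have mG : measurable_fun setT G.
  apply: measurableT_comp => //; apply: measurable_fun_pair; last exact: measurableT_comp.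
  by apply: measurable_cons => //; exact: measurableT_comp.
have mA : measurable_fun setT A by apply: measurable_iterE_param.
have AB z : `|A z| <= M * B.
  have mGz : measurable_fun setT (fun t => G (z, t)).
    by apply: measurableT_comp => //; exact: measurable_pair1.
  exact: (HB _ _ M0 mGz (fun c => HM _)).2.
transitivity (int_ab (lo 0%N) (hi 0%N) (fun z => int_ab l h (fun y => d 0%N z * A (z, y)))).
  apply: eq_int_ab => z _.
  rewrite (IH _ _ _ (fun ty => H (cons_tuple z ty.1, ty.2)))//.
  - rewrite /int_ab RintegralZl//; apply: (@integrable_bounded_itv R _ _ (M * B)) => //.
    by apply: measurableT_comp => //; exact: measurable_pair1.
  - apply: measurableT_comp => //; apply: measurable_fun_pair => //.
    by apply: measurable_cons.
apply: (@int_abC R _ _ _ _ (M * B) (fun zy => d 0%N zy.1 * A zy) (d 0%N)) => //.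
  by apply: measurable_funM => //; exact: measurableT_comp.
by move=> x y; rewrite normrM ler_wpM2l.
Qed.

End IteratedExchange.

(** * The expected information rent *)

Section InformationRent.
Set Implicit Arguments.
Unset Strict Implicit.
Context {R : realType}.
Notation mu := (@lebesgue_measure R).

Lemma measurable_upd (n : nat) (i : 'I_n) :
  measurable_fun setT (fun z : n.-tuple R * R => upd z.1 i z.2).
Proof.
apply/measurable_fun_tnthP => j.
rewrite (_ : _ \o _ = fun z => if j == i then z.2 else tnth z.1 j); last first.
  by apply/funext => z /=; rewrite tnth_mktuple.
case: (j == i); first exact: measurable_snd.
exact: (measurableT_comp (measurable_tnth j) measurable_fst).
Qed.

Lemma measurable_primitive (d : R -> R) (a : R) :
  measurable_fun setT d -> measurable_fun setT (fun z => int_ab a z d).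
Proof.
move=> md; apply: (measurable_int_ab_param (fun=> a) (fun z => z) (fun z => d z.2)) => //.
exact: measurableT_comp.
Qed.

(** The bound is uniform in the endpoints, so a primitive of an integrable function is bounded. *)
Lemma norm_int_ab_le_Rintegral (a b : R) (f : R -> R) :
  mu.-integrable setT (EFin \o f) -> `|int_ab a b f| <= \int[mu]_x `|f x|.
Proof.
move=> if_; have iab : mu.-integrable `[a, b] (EFin \o f) by exact: integrableS if_.
apply: le_trans (le_normr_Rintegral _ iab) _ => //.
rewrite Rintegral_mkcond; apply: le_Rintegral => //.
- rewrite -restrict_EFin; apply: (integrable_mkcond _ _).1 => //.
  exact: (integrable_norm iab).
- exact: (integrable_norm if_).
- by move=> x _; rewrite patchE; case: ifP => _ //=; exact: normr_ge0.
Qed.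

(** Covers integrands that are unbounded in one coordinate: domination by the weight [|w|] on
    coordinate [i] and by 1 on the others, where [w] has to be integrable only against [d i]. *)
Lemma iter_integrable_coord (n : nat) (lo hi : nat -> R) (d : nat -> R -> R)
    (i : 'I_n) (w : R -> R) (F : n.-tuple R -> R) :
  (forall k, mu.-integrable setT (EFin \o d k)) ->
  measurable_fun setT w ->
  mu.-integrable `[lo i, hi i] (EFin \o (fun z => d i z * w z)) ->
  measurable_fun setT F ->
  (forall c, in_supp lo hi c -> `|F c| <= `|w (tnth c i)|) ->
  iter_integrable lo hi d F.
Proof.
move=> id mw idw mF Fw.
pose h (k : nat) z := if k == i :> nat then `|w z| else 1.
have md k := measurable_integrableT (id k).
have [//||k|B _ HB] := @iter_integrable_dominated R n lo hi d h.
- by move=> k z; rewrite /h; case: ifP.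
- rewrite /h; case: eqP => [->|_].
    apply: le_integrable idw => //.
      apply/measurable_EFinP/measurable_funTS/measurable_funM; first exact: md.
      exact: measurableT_comp.
    by move=> z _ /=; rewrite lee_fin !normrM normr_id.
  have ik : mu.-integrable `[lo k, hi k] (EFin \o d k) by exact: integrableS (id k).
  by apply: eq_integrable ik => // x _ /=; rewrite mulr1.
apply: (HB F 1 ler01 mF _).1 => c cb; rewrite mul1r (bigD1 i)//= /h eqxx.
rewrite big1 ?mulr1; first exact: Fw.
by move=> j ji; rewrite ifN.
Qed.

(** The product is the primitive where [d] is nonzero and 0 elsewhere, hence bounded even if the
    ratio is not. *)
Lemma integrable_mul_inverse_hazard (d : R -> R) (a b : R) :
  mu.-integrable setT (EFin \o d) ->
  mu.-integrable `[a, b] (EFin \o (fun z => d z * (int_ab a z d / d z))).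
Proof.
move=> id; have md := measurable_integrableT id.
apply: (@integrable_bounded_itv _ _ _ (\int[mu]_x `|d x|)).
  apply: measurable_funM => //; apply: measurable_funM.
    exact: measurable_primitive.
  by apply: measurableT_comp => //; exact: measurable_invr.
move=> z; apply: le_trans (norm_int_ab_le_Rintegral a z id).
have [->|dz] := eqVneq (d z) 0; first by rewrite mul0r normr0.
by rewrite mulrCA divff// mulr1.
Qed.

Lemma iterE_information_rent (n : nat) (lo hi : nat -> R) (d : nat -> R -> R)
    (i : 'I_n) (a : n.-tuple R -> R) (M : R) :
  (forall k, mu.-integrable setT (EFin \o d k)) ->
  (forall z, lo i < z < hi i -> d i z != 0) ->
  measurable_fun setT a -> (forall c, `|a c| <= M) ->
  iterE lo hi d (fun c => a c * (int_ab (lo i) (tnth c i) (d i) / d i (tnth c i))) =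
  iterE lo hi d (fun c => int_ab (tnth c i) (hi i) (fun z => a (upd c i z))).
Proof.
elim: n lo hi d i a => [|n IH] lo hi d i a id d0 ma aM; first by case: i d0.
have ma2 z : measurable_fun setT (fun t : n.-tuple R => a (cons_tuple z t)).
  by apply: measurableT_comp => //; exact: measurable_cons.
case: (unliftP ord0 i) d0 => [j ->|->] d0 /=.
  (* Coordinate [i] is not the first: with the first one fixed at [z], the section of [a] is again a
     bounded measurable allocation, and [upd] acts on the tail. *)
  apply: eq_int_ab => z _; congr (_ * _).
  have := IH (fun k => lo k.+1) (fun k => hi k.+1) (fun k => d k.+1) j
    (fun t => a (cons_tuple z t)) (fun k => id k.+1) _ (ma2 z) (fun t => aM _).
  rewrite lift0 in d0 *; move=> /(_ d0) E.
  apply: etrans (etrans _ E) _; apply: eq_iterE => // t _; rewrite tnthS//.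
  by apply: eq_int_ab => y _; rewrite upd_consS.
have M0 : 0 <= M := le_trans (normr_ge0 _) (aM [tuple 0 | _ < n.+1]).
have [B B0 HB] := @iter_integrable_bounded R n (fun k => lo k.+1)
  (fun k => hi k.+1) (fun k => d k.+1) (fun k => id k.+1).
(* Coordinate [i] is the first: [A y] is its interim allocation at report [y], averaged over all
   other costs. *)
pose A (y : R) := iterE (fun k => lo k.+1) (fun k => hi k.+1) (fun k => d k.+1)
  (fun t : n.-tuple R => a (cons_tuple y t)).
have ma3 : measurable_fun setT (fun yt : R * n.-tuple R => a (cons_tuple yt.1 yt.2)).
  by apply: measurableT_comp => //; exact: measurable_cons.
have md k := measurable_integrableT (id k).
have mA : measurable_fun setT A.
  exact: (@measurable_iterE_param R _ _ n _ _ _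
    (fun yt : R * n.-tuple R => a (cons_tuple yt.1 yt.2))).
have AB y : `|A y| <= M * B := (HB _ _ M0 (ma2 y) (fun t => aM _)).2.
have mC := measurable_primitive (lo 0%N) (md 0%N).
(* Both sides equal the integral of the primitive of [d 0] times [A]; on the left [d 0] cancels in
   the open interval. *)
transitivity (int_ab (lo 0%N) (hi 0%N) (fun y => int_ab (lo 0%N) y (d 0%N) * A y)).
  transitivity (int_ab (lo 0%N) (hi 0%N) (fun z => d 0%N z *
      ((int_ab (lo 0%N) z (d 0%N) / d 0%N z) * A z))).
    apply: eq_int_ab => z _; congr (_ * _).
    rewrite -(iterEZ _ (HB _ _ M0 (ma2 z) (fun t => aM _)).1).2.
    by apply: eq_iterE => // t _; rewrite tnth0 mulrC.
  apply: eq_int_ab_oo.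
  - apply: measurable_funM => //; apply: measurable_funM => //.
    apply: measurable_funM => //.
    by apply: measurableT_comp => //; exact: measurable_invr.
  - exact: measurable_funM.
  - by move=> z /d0 dz; rewrite mulrA mulrCA divff// mulr1.
(* The triangle exchange yields the integral of [A] above [z], weighted by [d 0]; it then remains to
   move the other coordinates past the integral in [y]. *)
rewrite -(int_ab_triangle _ _ (id 0%N) mA AB); apply: eq_int_ab => z _.
congr (_ * _).
have mH : measurable_fun setT (fun ty : n.-tuple R * R => a (cons_tuple ty.2 ty.1)).
  by apply: measurableT_comp => //; exact: measurable_cons.
rewrite -(@iterE_int_ab R n _ _ _ z (hi 0%N) M _ (fun k => id k.+1) mH (fun t => aM _)).
by apply: eq_iterE => // t _; apply: eq_int_ab => y _; rewrite upd_cons0.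
Qed.

End InformationRent.

(** * Expected revenue as expected virtual welfare *)

Theorem theorem3 (R : realType) (n : nat)
  (lo hi : nat -> R) (C dens : nat -> R -> R) (lam : nat -> R -> R)
  (alloc pay : n.-tuple R -> n.-tuple R -> 'I_n -> R) (p : n.-tuple R) :
  (* cost distributions: C_i is the CDF on [lo_i, hi_i] with density dens_i *)
  (forall i : 'I_n, lo i < hi i) ->
  (forall i : 'I_n, (@lebesgue_measure R).-integrable `[lo i, hi i] (EFin \o dens i)) ->
  (forall (i : 'I_n) (z : R), lo i < z < hi i -> 0 < dens i z) ->
  (forall (i : 'I_n) (z : R), lo i <= z <= hi i -> C i z = int_ab (lo i) z (dens i)) ->
  (forall i : 'I_n, int_ab (lo i) (hi i) (dens i) = 1) ->
  (* conversion rates in (0, 1] *)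
  (forall (i : nat) (x : R), 0 < lam i x <= 1) ->
  (* allocations in {0,1}, at most one winner *)
  (forall c q (i : 'I_n), alloc c q i = 0 \/ alloc c q i = 1) ->
  (forall c q, \sum_(i < n) alloc c q i <= 1) ->
  (* regularity: allocations are measurable in the cost profile *)
  (forall q (i : 'I_n), measurable_fun setT (fun c : n.-tuple R => alloc c q i)) ->
  (* IC *)
  (forall (i : 'I_n) (c q : n.-tuple R) (z : R),
      in_supp lo hi c -> lo i <= z <= hi i ->
      utility lam alloc pay i (tnth c i) (upd c i z) q
        <= utility lam alloc pay i (tnth c i) c q) ->
  (* IR *)
  (forall (i : 'I_n) (c q : n.-tuple R),
      in_supp lo hi c -> 0 <= utility lam alloc pay i (tnth c i) c q) ->
  (* payment rule *)
  (forall (i : 'I_n) (c q : n.-tuple R), in_supp lo hi c ->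
      pay c q i = value lam i (tnth c i) (tnth q i) * alloc c q i
        - lam i (tnth q i) * int_ab (tnth c i) (hi i) (fun z => alloc (upd c i z) q i)) ->
  iterE lo hi dens (fun c => \sum_(i < n) pay c p i)
  = iterE lo hi dens (fun c => \sum_(i < n)
        alloc c p i * virtual_value lam C dens i (tnth c i) (tnth p i)).
Proof.
move=> _ idens dens0 CE _ lam01 alloc01 _ malloc _ _ payE.
set mu := @lebesgue_measure R.
(* [dens] is unconstrained outside [lo, hi] and beyond index [n]; [d] is
   globally measurable and gives the same iterated integrals. *)
pose d (k : nat) := if (k < n)%N then (dens k) \_ `[lo k, hi k] else cst 0.
have dE (i : 'I_n) z : lo i <= z <= hi i -> dens i z = d i z.
  by move=> zb; rewrite /d ltn_ord patchE mem_setE in_itv/= zb.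
have id k : mu.-integrable setT (EFin \o d k).
  rewrite /d; case: ifPn => [kn|_].
    rewrite -restrict_EFin; apply: (integrable_mkcond _ _).1 => //.
    exact: (idens (Ordinal kn)).
  exact: integrable0.
have md k := measurable_integrableT (id k).
have d0 (i : 'I_n) z : lo i < z < hi i -> d i z != 0.
  move=> zb; rewrite -dE; first by rewrite gt_eqF// dens0.
  by case/andP: zb => lz zh; rewrite !ltW.
have CdE (i : 'I_n) z : lo i <= z <= hi i -> C i z = int_ab (lo i) z (d i).
  move=> zb; rewrite CE//; apply: eq_int_ab => y /andP[ly yz]; apply: dE.
  by rewrite ly (le_trans yz)//; case/andP: zb.
pose a (i : 'I_n) c := alloc c p i.
have ma i : measurable_fun setT (a i) by exact: malloc.
have a1 i c : `|a i c| <= 1.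
  by rewrite /a; case: (alloc01 c p i) => ->; rewrite ?normr0 ?normr1.
(* [X] is the value term common to both sides, [Y] the information rent and [Z] its form in the
   virtual value, the latter two without the factor [lam]. *)
pose X i c := a i c * value lam i (tnth c i) (tnth p i).
pose Y i c := int_ab (tnth c i) (hi i) (fun z => a i (upd c i z)).
pose Z i c := a i c * (int_ab (lo i) (tnth c i) (d i) / d i (tnth c i)).
have mt (i : 'I_n) : measurable_fun setT (fun c : n.-tuple R => tnth c i).
  exact: measurable_tnth.
have iter_integrable_box (i : 'I_n) K (F : n.-tuple R -> R) : measurable_fun setT F ->
    (forall c, in_supp lo hi c -> `|F c| <= K) -> iter_integrable lo hi d F.
  move=> mF FK; apply: (@iter_integrable_coord _ _ _ _ _ i (cst K)) => //.
    have idi : mu.-integrable `[lo i, hi i] (EFin \o d i) by exact: integrableS (id i).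
    by apply: eq_integrable (integrableZr _ K idi).
  by move=> c cb; rewrite (le_trans (FK c cb))// ler_norm.
have iX i : iter_integrable lo hi d (X i).
  (* On the support [|c_i|] is at most [|lo i| + |hi i|], while allocation and conversion rate are
     at most 1. *)
  apply: (iter_integrable_box i (`|tnth p i| + (`|lo i| + `|hi i|))).
    apply: measurable_funM => //; apply: measurable_funM => //.
    exact: measurable_funB.
  move=> c /(_ i)/andP[lc ch]; rewrite /X /value normrM.
  apply: (@le_trans _ _ (1 * (`|tnth p i - tnth c i| * 1))).
    apply: ler_pM => //; rewrite normrM; apply: ler_pM => //.
    by have /andP[/ltW l0 l1] := lam01 i (tnth p i); rewrite ger0_norm.
  rewrite mul1r mulr1 (le_trans (ler_normB _ _))// lerD2l.
  rewrite ler_norml; apply/andP; split.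
    have lo_le : - lo i <= `|lo i| by rewrite -normrN ler_norm.
    by rewrite lerNl (@le_trans _ _ (- lo i)) ?lerN2// (le_trans lo_le)// lerDl.
  by rewrite (le_trans ch)// (le_trans (ler_norm _))// lerDr.
have iY i : iter_integrable lo hi d (Y i).
  apply: (iter_integrable_box i (1 * `|hi i - lo i|)).
    apply: (measurable_int_ab_param _ (fun=> hi i) (fun cz => a i (upd cz.1 i cz.2))) => //.
    by apply: measurableT_comp => //; exact: measurable_upd.
  move=> c /(_ i)/andP[lc ch]; rewrite /Y.
  apply: le_trans (norm_int_ab_le _ _ 1 _ _ ler01 _) _ => //.
    have mcz : measurable_fun setT (fun z : R => (c, z)) by exact: measurable_pair1.
    exact: (measurableT_comp (ma i) (measurableT_comp (measurable_upd i) mcz)).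
  by rewrite !mul1r !ger0_norm ?subr_ge0 ?(le_trans lc)// lerD2l lerN2.
have iZ i : iter_integrable lo hi d (Z i).
  have mw : measurable_fun setT (fun z => int_ab (lo i) z (d i) / d i z).
    apply: measurable_funM; first exact: measurable_primitive.
    by apply: measurableT_comp => //; exact: measurable_invr.
  (* The ratio may be unbounded where [d i] is small, so it serves itself as the dominating
     weight. *)
  apply: (iter_integrable_coord id mw).
  - exact: integrable_mul_inverse_hazard.
  - by apply: measurable_funM => //; exact: (measurableT_comp mw (mt i)).
  - by move=> c _; rewrite normrM ler_piMl.
pose l (i : 'I_n) := - lam i (tnth p i).
(* The payment rule on the left and the formula for the virtual value on the right leave integrands
   that differ only in [Y] against [Z]. *)
rewrite (@eq_iterE _ _ _ _ _ d _ (fun c => \sum_(i < n) (X i c + l i * Y i c)))//; last first.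
  by move=> c cb; apply: eq_bigr => i _; rewrite payE// /l mulNr mulrC.
rewrite [RHS](@eq_iterE _ _ _ _ _ d _ (fun c => \sum_(i < n) (X i c + l i * Z i c)))//; last first.
  move=> c cb; apply: eq_bigr => i _; rewrite /virtual_value (CdE _ _ (cb i)) dE//.
  by rewrite mulrBr /l mulNr; congr (_ - _); exact: mulrCA.
rewrite !(iterE_sum _ _).2; last 2 first.
- by move=> i; apply: (iterED _ _).1 => //; exact: (iterEZ _ _).1.
- by move=> i; apply: (iterED _ _).1 => //; exact: (iterEZ _ _).1.
apply: eq_bigr => i _.
rewrite (iterED (iX i) (iterEZ (l i) (iY i)).1).2 (iterEZ (l i) (iY i)).2.
rewrite (iterED (iX i) (iterEZ (l i) (iZ i)).1).2 (iterEZ (l i) (iZ i)).2.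
by rewrite (iterE_information_rent id (d0 i) (ma i) (a1 i)).
Qed.
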